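(* Let $n\ge2$. Let $A_1=\{1\text{-}23\}$, $A_2=\{2\text{-}31,23\text{-}1\}$, $A_3=\{1\text{-}32,13\text{-}2\}$, $A_4=\{3\text{-}12,31\text{-}2\}$. For every choice of $p_i\in A_i$ ($i=1,2,3,4$), $|S_n(p_1,p_2,p_3,p_4)|=2$ and $$S_n(p_1,p_2,p_3,p_4)=\{\,n\,(n-1)\ldots 3\,2\,1,\ \ (n-1)\,(n-2)\ldots 3\,2\,1\,n\,\}.$$
   Context: $S_n$ is the set of permutations $\pi=\pi_1\pi_2\cdots\pi_n$ of $\{1,\dots,n\}$ (written in one-line notation). For $abc$ a permutation of $123$, the generalized pattern $a\text{-}bc$ is contained in $\pi$ if there are indices $i<j$ with $j+1\le n$ such that $\pi_i\pi_j\pi_{j+1}$ is order-isomorphic to $abc$; the generalized pattern $ab\text{-}c$ is contained in $\pi$ if there are indices $i,k$ with $i+1<k\le n$ such that $\pi_i\pi_{i+1}\pi_k$ is order-isomorphic to $abc$. $\pi$ avoids a pattern if it does not contain it. $S_n(p_1,\dots,p_m)$ is the set of $\pi\in S_n$ avoiding all of $p_1,\dots,p_m$. *)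

(* Defs.v *)
From HB Require Import structures.
From mathcomp Require Import all_boot all_fingroup.

Set Implicit Arguments.
Unset Strict Implicit.
Unset Printing Implicit Defensive.

(* [dash1 a b c] is the generalized pattern a-bc and [dash2 a b c] is ab-c. *)
Inductive gpattern := dash1 of nat & nat & nat | dash2 of nat & nat & nat.

Definition gpattern_code (p : gpattern) :
    (nat * nat * nat) + (nat * nat * nat) :=
  match p with
  | dash1 a b c => inl (a, b, c)
  | dash2 a b c => inr (a, b, c)
  end.

Definition gpattern_decode (x : (nat * nat * nat) + (nat * nat * nat)) :
    gpattern :=
  match x with
  | inl (a, b, c) => dash1 a b c
  | inr (a, b, c) => dash2 a b c
  end.

Lemma gpattern_codeK : cancel gpattern_code gpattern_decode.
Proof. by case. Qed.

HB.instance Definition _ := Equality.copy gpattern (can_type gpattern_codeK).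

Definition order_iso (s t : seq nat) : bool :=
  (size s == size t) &&
  [forall i : 'I_(size s), forall j : 'I_(size s),
     (nth 0 s i < nth 0 s j) == (nth 0 t i < nth 0 t j)].

(* Positions and values of [pi : 'S_n] run over 0, ..., n - 1. The side
   condition j + 1 <= n (resp. i + 1 <= n) is carried by the type of the
   ordinal equal to the successor. *)
Definition contains (n : nat) (pi : 'S_n) (p : gpattern) : bool :=
  match p with
  | dash1 a b c =>
      [exists i : 'I_n, exists j : 'I_n, exists k : 'I_n,
        [&& i < j, val k == j.+1
          & order_iso [:: val (pi i); val (pi j); val (pi k)] [:: a; b; c]]]
  | dash2 a b c =>
      [exists i : 'I_n, exists j : 'I_n, exists k : 'I_n,
        [&& val j == i.+1, j < k
          & order_iso [:: val (pi i); val (pi j); val (pi k)] [:: a; b; c]]]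
  end.

Definition avoids (n : nat) (pi : 'S_n) (p : gpattern) : bool :=
  ~~ contains pi p.

Definition avoiders (n : nat) (ps : seq gpattern) : {set 'S_n} :=
  [set pi : 'S_n | all (avoids pi) ps].

(* One-line notation, with values shifted back to 1, ..., n. *)
Definition one_line (n : nat) (pi : 'S_n) : seq nat :=
  [seq (val (pi i)).+1 | i <- enum 'I_n].

Definition A1 : seq gpattern := [:: dash1 1 2 3].
Definition A2 : seq gpattern := [:: dash1 2 3 1; dash2 2 3 1].
Definition A3 : seq gpattern := [:: dash1 1 3 2; dash2 1 3 2].
Definition A4 : seq gpattern := [:: dash1 3 1 2; dash2 3 1 2].

(* Main.v *)
(* An ascent a < b at adjacent positions j, j+1 of an avoider must be at the end:
   by 23-1 the entry after b would exceed a, and a together with b and that entry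
   would form 1-23 or 1-32.  By 3-12 every entry before a is then smaller than b,
   so b = n.  Hence an avoider is decreasing, or decreasing followed by n.
   The other choices in A2, A3, A4 are stronger: an occurrence of 23-1, 1-32 or
   3-12 yields one of 2-31, 13-2 or 31-2 at an adjacent pair, lying between the
   two entries next to the dash, where the permutation crosses the third value. *)
Require Import Defs.
From mathcomp Require Import all_boot all_fingroup zify.

Set Implicit Arguments.
Unset Strict Implicit.
Unset Printing Implicit Defensive.

(** * Triples, crossings and decreasing sequences *)

Lemma order_iso3P (x y z a b c : nat) :
  reflect [/\ [/\ (x < y) = (a < b), (x < z) = (a < c) & (y < z) = (b < c)],
              (y < x) = (b < a), (z < x) = (c < a) & (z < y) = (c < b)]
          (order_iso [:: x; y; z] [:: a; b; c]).
Proof.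
rewrite /order_iso eqxx andTb; apply: (iffP idP) => [h | [[h1 h2 h3] h4 h5 h6]].
  have e i j : i < 3 -> j < 3 ->
      (nth 0 [:: x; y; z] i < nth 0 [:: x; y; z] j) =
      (nth 0 [:: a; b; c] i < nth 0 [:: a; b; c] j).
    by move=> hi hj; have /forallP/(_ (Ordinal hj))/eqP :=
      forallP h (Ordinal hi).
  by split; [split; [exact: (e 0 1)|exact: (e 0 2)|exact: (e 1 2)]
            | exact: (e 1 0)|exact: (e 2 0)|exact: (e 2 1)].
by apply/forallP=> -[[|[|[|i]]] hi] //; apply/forallP=> -[[|[|[|j]]] hj] //=;
   apply/eqP; rewrite ?ltnn.
Qed.

(** A discrete intermediate value argument: either [P] holds just before the right end, which gives
    the crossing, or that end moves one step left. *)
Lemma crossing (P : pred nat) (a b : nat) :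
  a <= b -> P a -> ~~ P b -> exists2 j, a <= j < b & P j && ~~ P j.+1.
Proof.
move=> /subnKC <-; elim: (b - a) => [|d IHd] Pa; first by rewrite addn0 Pa.
rewrite addnS; have [Pd nP | nPd _] := boolP (P (a + d)).
  by exists (a + d); rewrite ?Pd //; lia.
by have [j hj Pj] := IHd Pa nPd; exists j => //; lia.
Qed.

(** There is no slack: descending from [g 0 <= m] gives [g j <= m - j], and climbing back from
    position [m] gives [d <= g (m - d)]. *)
Lemma decreasing_val (m : nat) (g : nat -> nat) :
  (forall i, i < m -> g i.+1 < g i) -> g 0 <= m ->
  forall i, i <= m -> g i = m - i.
Proof.
move=> gdec g0 i im.
have ub j : j <= m -> g j + j <= m.
  by elim: j => [|j IHj] jm; [lia | have := IHj (ltnW jm); have := gdec j jm; lia].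
have lb d : d <= m -> d <= g (m - d).
  elim: d => // d IHd dm; have := IHd (ltnW dm).
  have := gdec (m - d.+1); have -> : (m - d.+1).+1 = m - d by lia.
  by lia.
have := ub i im; have := lb (m - i) (leq_subr _ _); rewrite subKn //; lia.
Qed.

(** * Pattern avoidance with natural numbers as positions *)

Section Entries.
Variables (n : nat) (pi : 'S_n.+1).

(* Out of range, [entry i = entry 0] for [i > n]. *)
Definition entry (i : nat) : nat := val (pi (inord i)).

Lemma entryE (i : 'I_n.+1) : entry i = pi i.
Proof. by rewrite /entry inord_val. Qed.

Lemma entry_inj (i j : nat) : i <= n -> j <= n -> entry i = entry j -> i = j.
Proof.
move=> hi hj /val_inj/perm_inj/(congr1 val).
by rewrite /= !inordK.
Qed.

Lemma entry_le (i : nat) : entry i <= n.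
Proof. exact: leq_ord. Qed.

Lemma avoids_dash1P (a b c : nat) :
  reflect (forall i j, i < j -> j < n ->
             ~~ order_iso [:: entry i; entry j; entry j.+1] [:: a; b; c])
          (avoids pi (dash1 a b c)).
Proof.
apply: (iffP idP) => [av i j ij jn | h].
  apply: contra av => o; apply/existsP; exists (inord i).
  apply/existsP; exists (inord j); apply/existsP; exists (inord j.+1).
  by rewrite /= !inordK ?ij ?eqxx //; lia.
apply/existsP=> -[i /existsP[j /existsP[k /and3P[ij /eqP kj o]]]].
have jn : j < n by rewrite -ltnS -kj ltn_ord.
by have := h i j ij jn; rewrite -kj !entryE o.
Qed.

Lemma avoids_dash2P (a b c : nat) :
  reflect (forall i k, i.+1 < k -> k <= n ->
             ~~ order_iso [:: entry i; entry i.+1; entry k] [:: a; b; c])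
          (avoids pi (dash2 a b c)).
Proof.
apply: (iffP idP) => [av i k ik kn | h].
  apply: contra av => o; apply/existsP; exists (inord i).
  apply/existsP; exists (inord i.+1); apply/existsP; exists (inord k).
  by rewrite /= !inordK ?ik ?eqxx //; lia.
apply/existsP=> -[i /existsP[j /existsP[k /and3P[/eqP ji jk o]]]].
by have := h i k; rewrite -ji !entryE o jk -ltnS ltn_ord => /(_ isT isT).
Qed.

(** * Reduction to 23-1, 1-32 and 3-12 *)

Lemma avoids_A2 (p : gpattern) : p \in A2 -> avoids pi p ->
  avoids pi (dash2 2 3 1).
Proof.
rewrite !inE => /orP[]/eqP-> // /avoids_dash1P av.
apply/avoids_dash2P => i k ik kn; apply/negP=> /order_iso3P /= [[h1 h2 h3] h4 h5 h6].
(* Here [entry i] plays 2: the later entries are above it at [i.+1] and below it at [k]. *)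
have [||j hj /andP[Pj nPj]] :=
  crossing (P := fun j => entry i < entry j) (ltnW ik); rewrite ?h1 ?h2 //.
(* The crossing only gives [entry j.+1 <= entry i]; injectivity makes it strict. *)
have ne : entry i <> entry j.+1 by move=> /entry_inj; lia.
have /negP[] : ~~ order_iso [:: entry i; entry j; entry j.+1] [:: 2; 3; 1].
  by apply: av; lia.
by apply/order_iso3P => /=; split; [split|..]; lia.
Qed.

Lemma avoids_A3 (p : gpattern) : p \in A3 -> avoids pi p ->
  avoids pi (dash1 1 3 2).
Proof.
rewrite !inE => /orP[]/eqP-> // /avoids_dash2P av.
apply/avoids_dash1P => i k ik kn; apply/negP=> /order_iso3P /= [[h1 h2 h3] h4 h5 h6].
(* Now [entry k.+1] plays 2, and the crossing between [i] and [k] supplies the adjacent pair 13. *)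
have [||j hj /andP[Pj nPj]] :=
  crossing (P := fun j => entry j < entry k.+1) (ltnW ik); rewrite ?h2 ?h3 //.
have ne : entry k.+1 <> entry j.+1 by move=> /entry_inj; lia.
have /negP[] : ~~ order_iso [:: entry j; entry j.+1; entry k.+1] [:: 1; 3; 2].
  by apply: av; lia.
by apply/order_iso3P => /=; split; [split|..]; lia.
Qed.

Lemma avoids_A4 (p : gpattern) : p \in A4 -> avoids pi p ->
  avoids pi (dash1 3 1 2).
Proof.
rewrite !inE => /orP[]/eqP-> // /avoids_dash2P av.
apply/avoids_dash1P => i k ik kn; apply/negP=> /order_iso3P /= [[h1 h2 h3] h4 h5 h6].
(* Again [entry k.+1] is crossed, this time downwards, which supplies the adjacent pair 31. *)
have [||j hj /andP[Pj nPj]] :=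
  crossing (P := fun j => entry k.+1 < entry j) (ltnW ik); rewrite ?h5 ?h6 //.
have ne : entry k.+1 <> entry j.+1 by move=> /entry_inj; lia.
have /negP[] : ~~ order_iso [:: entry j; entry j.+1; entry k.+1] [:: 3; 1; 2].
  by apply: av; lia.
by apply/order_iso3P => /=; split; [split|..]; lia.
Qed.

(** * Ascents of an avoider, and the converse *)

Lemma avoider_ascent (j : nat) :
  avoids pi (dash1 1 2 3) -> avoids pi (dash2 2 3 1) ->
  avoids pi (dash1 1 3 2) -> avoids pi (dash1 3 1 2) ->
  j < n -> entry j < entry j.+1 -> j.+1 = n /\ entry n = n.
Proof.
move=> /avoids_dash1P a1 /avoids_dash2P a2 /avoids_dash1P a3 /avoids_dash1P a4.
move=> jn asc; have [jn' | jn'] := ltnP j.+1 n.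
  have ne1 : entry j <> entry j.+2 by move=> /entry_inj; lia.
  have ne2 : entry j.+1 <> entry j.+2 by move=> /entry_inj; lia.
  have lt : entry j < entry j.+2.
    apply: contraNT (a2 j j.+2 _ _) => // h.
    by apply/order_iso3P => /=; split; [split|..]; lia.
  have [h | h] := ltnP (entry j.+1) (entry j.+2).
    suff /negP[] : ~~ order_iso [:: entry j; entry j.+1; entry j.+2] [:: 1; 2; 3].
      by apply/order_iso3P => /=; split; [split|..]; lia.
    by apply: a1.
  suff /negP[] : ~~ order_iso [:: entry j; entry j.+1; entry j.+2] [:: 1; 3; 2].
    by apply/order_iso3P => /=; split; [split|..]; lia.
  by apply: a3.
have ejn : j.+1 = n by lia.
split=> //; apply/eqP; rewrite eqn_leq entry_le /=.
(* The last entry is compared with the maximum, attained at [i]: at [j] the ascent bounds it, and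
   before [j] a value above [entry j.+1] would give 3-12. *)
have [i ei] : exists i : 'I_n.+1, entry i = n.
  by exists (pi^-1 ord_max)%g; rewrite entryE permKV.
rewrite -{1}ei; have [ij | ij] := ltnP i j; last first.
  have [-> // | ->] : val i = n \/ val i = j by have := ltn_ord i; rewrite /=; lia.
  by rewrite -[in leqRHS]ejn ltnW.
rewrite -[in leqRHS]ejn leqNgt; apply: contraNN (a4 i j ij jn) => h.
by apply/order_iso3P => /=; split; [split|..]; lia.
Qed.

(** Under this hypothesis every triple of entries, adjacent or not, has the shape 321 or 213, and
    none of the seven patterns has these shapes. *)
Lemma avoids_all (p : gpattern) :
  (forall i j, i < j <= n -> entry i < entry j -> j = n /\ entry n = n) ->
  p \in A1 ++ A2 ++ A3 ++ A4 -> avoids pi p.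
Proof.
move=> h; have h3 i j k : i < j -> j < k -> k <= n ->
    (entry j < entry i) /\ (entry j < entry k -> entry i < entry k).
  move=> ij jk kn.
  have ne1 : entry i <> entry j by move=> /entry_inj; lia.
  have ne2 : entry i <> entry k by move=> /entry_inj; lia.
  split; first by have := h i j; lia.
  move=> hjk; have [||? e] := h j k; [lia|lia|subst k].
  by rewrite e in ne2 *; have := entry_le i; lia.
rewrite !inE; do 6?case/orP; move=> /eqP->;
  (apply/avoids_dash1P || apply/avoids_dash2P) => i j ij jn;
  apply/negP => /order_iso3P /= [[? ? ?] ? ? ?].
- by have := h3 i j j.+1; lia.
- by have := h3 i j j.+1; lia.
- by have := h3 i i.+1 j; lia.
- by have := h3 i j j.+1; lia.
- by have := h3 i i.+1 j; lia.
- by have := h3 i j j.+1; lia.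
- by have := h3 i i.+1 j; lia.
Qed.

End Entries.

(** * The two permutations and their one-line notation *)

Lemma entry_ext (n : nat) (p q : 'S_n.+1) :
  (forall i, i <= n -> entry p i = entry q i) -> p = q.
Proof.
move=> h; apply/permP=> i; apply: val_inj.
by rewrite /= -!entryE; apply: h; rewrite -ltnS.
Qed.

Lemma one_lineE (n : nat) (pi : 'S_n.+1) :
  one_line pi = mkseq (fun i => (entry pi i).+1) n.+1.
Proof.
rewrite /one_line /mkseq -val_enum_ord -map_comp.
by apply: eq_map => i /=; rewrite entryE.
Qed.

Definition rev_perm (n : nat) : 'S_n := perm (@rev_ord_inj n).

Lemma ord_pred_rev_inj (n : nat) : injective (@ord_pred n \o @rev_ord n).
Proof. exact: inj_comp (can_inj (@ord_predK n)) (@rev_ord_inj n). Qed.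

(** Since [ord_pred] is cyclic, it lowers each value of the decreasing permutation by one and sends
    the final 0 to the maximum. *)
Definition pred_rev_perm (n : nat) : 'S_n := perm (@ord_pred_rev_inj n).

Lemma entry_rev_perm (n i : nat) : i <= n -> entry (rev_perm n.+1) i = n - i.
Proof. by move=> hi; rewrite /entry permE /= inordK. Qed.

Lemma entry_pred_rev_perm (n i : nat) : i <= n ->
  entry (pred_rev_perm n.+1) i = if i == n then n else n - i.+1.
Proof.
move=> hi; rewrite /entry permE /= inordK // subSS.
have [-> | ne] := eqVneq; first by rewrite subnn add0n modn_small.
have -> : (n - i + n.+1).-1 = n - i.+1 + n.+1 by lia.
by rewrite modnDr modn_small //; lia.
Qed.

Lemma one_line_rev_perm (n : nat) :
  one_line (rev_perm n.+1) = rev (iota 1 n.+1).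
Proof.
rewrite one_lineE; apply: (@eq_from_nth _ 0).
  by rewrite size_mkseq size_rev size_iota.
move=> i; rewrite size_mkseq => hi.
rewrite nth_mkseq // entry_rev_perm // nth_rev size_iota // nth_iota; lia.
Qed.

Lemma one_line_pred_rev_perm (n : nat) :
  one_line (pred_rev_perm n.+1) = rcons (rev (iota 1 n)) n.+1.
Proof.
rewrite one_lineE; apply: (@eq_from_nth _ 0).
  by rewrite size_mkseq size_rcons size_rev size_iota.
move=> i; rewrite size_mkseq => hi.
rewrite nth_mkseq // entry_pred_rev_perm // nth_rcons size_rev size_iota.
have [-> | ne] := eqVneq; first by rewrite ltnn.
have lt : i < n by lia.
by rewrite lt nth_rev size_iota // nth_iota; lia.
Qed.

(** * Determination of the avoiders *)

Lemma avoidersE (n : nat) (p1 p2 p3 p4 : gpattern) :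
  p1 \in A1 -> p2 \in A2 -> p3 \in A3 -> p4 \in A4 ->
  avoiders n.+1 [:: p1; p2; p3; p4] = [set rev_perm n.+1; pred_rev_perm n.+1].
Proof.
move=> h1 h2 h3 h4; apply/setP=> pi; rewrite !inE /= andbT.
apply/and4P/orP=> [[a1 a2 a3 a4] | pi12].
  move: h1 a1; rewrite inE => /eqP-> a1.
  have asc j := avoider_ascent (j := j) a1 (avoids_A2 h2 a2) (avoids_A3 h3 a3)
    (avoids_A4 h4 a4).
  have dec j : j < n -> (entry pi n == n) && (j.+1 == n) || (entry pi j.+1 < entry pi j).
    move=> jn; have ne : entry pi j <> entry pi j.+1 by move=> /entry_inj; lia.
    have [/(asc j jn)[-> ->] | ] := ltnP (entry pi j) (entry pi j.+1).
      by rewrite !eqxx.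
    by lia.
  (* If the last entry is not [n], all steps descend; otherwise the first [n] entries descend and
     are treated separately. *)
  have [en | en] := eqVneq (entry pi n) n; last first.
    left; apply/eqP/entry_ext => i hi; rewrite entry_rev_perm //.
    by apply: decreasing_val => // [j /dec|]; [rewrite (negPf en)|exact: entry_le].
  right; apply/eqP/entry_ext => i hi; rewrite entry_pred_rev_perm //.
  have [-> // | ne] := eqVneq; have -> : n - i.+1 = n.-1 - i by lia.
  apply: decreasing_val; last by lia.
    by move=> j hj; have := dec j; lia.
  (* The value [n] is taken at the end, and position 0 is not the end because [i < n]; so the first
     entry is at most [n.-1]. *)
  have := entry_le pi 0; have : entry pi 0 <> entry pi n by move=> /entry_inj; lia.
  by rewrite en; lia.
have av p : p \in A1 ++ A2 ++ A3 ++ A4 -> avoids pi p.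
  apply: avoids_all => i j hij.
  case: pi12 => /eqP->.
    by rewrite !entry_rev_perm; lia.
  by rewrite !entry_pred_rev_perm ?eqxx; do ?case: eqP; lia.
by split; apply: av; rewrite !mem_cat ?h1 ?h2 ?h3 ?h4 ?orbT.
Qed.

Theorem proposition2p5 (n : nat) (hn : 2 <= n) (p1 p2 p3 p4 : gpattern)
    (h1 : p1 \in A1) (h2 : p2 \in A2) (h3 : p3 \in A3) (h4 : p4 \in A4) :
  #|avoiders n [:: p1; p2; p3; p4]| = 2 /\
  [seq one_line pi | pi in avoiders n [:: p1; p2; p3; p4]]
    =i [:: rev (iota 1 n); rcons (rev (iota 1 n.-1)) n].
Proof.
case: n hn => [|n] // hn; rewrite (avoidersE n h1 h2 h3 h4); split.
  rewrite cards2; suff -> : rev_perm n.+1 != pred_rev_perm n.+1 by [].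
  (* The last entries are 0 and [n], distinct because [hn] makes [n] positive. *)
  apply/eqP=> /(congr1 (fun pi => entry pi n)).
  by rewrite entry_rev_perm // entry_pred_rev_perm // eqxx; lia.
move=> s; rewrite !inE -one_line_rev_perm -one_line_pred_rev_perm.
apply/imageP/orP=> [[pi] | [] /eqP->].
- by rewrite !inE => /orP[]/eqP-> ->; [left|right].
- by exists (rev_perm n.+1); rewrite ?inE ?eqxx.
- by exists (pred_rev_perm n.+1); rewrite ?inE ?eqxx ?orbT.
Qed.
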